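(* The subgroup of the topological full group $[[\sigma|\Omega(\xi_{\mathrm{Mu}})]]$ generated by the involutions $\delta_a$, $\delta_c$ and $\delta_d$ has intermediate growth.
   Context: Let $\mathcal{A}=\{a,c,d\}$ and $\mathbb{N}=\{1,2,\dots\}$. $\mathcal{A}^{\mathbb{Z}}$ is the set of bi-infinite strings $\ldots x_{-1}x_0.x_1x_2\ldots$ with the product topology, $\mathcal{A}$ being discrete; the shift $\sigma$ is given by $(\sigma(\omega))(n)=\omega(n+1)$. $\xi_{\mathrm{Mu}}\in\{a,c,d\}^{\mathbb{N}}$ is the unique infinite string beginning with $a$ preserved by the substitution $a\to aca$, $c\to d$, $d\to c$ (applied letter by letter with concatenation). $\Omega(\xi_{\mathrm{Mu}})$ is the set of all $\omega\in\mathcal{A}^{\mathbb{Z}}$ such that every (finite, nonempty, contiguous) subword of $\omega$ is a subword of $\xi_{\mathrm{Mu}}$; it is a Cantor set with $\sigma(\Omega(\xi_{\mathrm{Mu}}))=\Omega(\xi_{\mathrm{Mu}})$, and $\sigma|\Omega(\xi_{\mathrm{Mu}})$ is the restriction of the shift. For a homeomorphism $T:X\to X$ of a Cantor set, $[[T]]$ is the group of all homeomorphisms $F:X\to X$ of the form $F(x)=T^{\nu(x)}(x)$ with $\nu:X\to\mathbb{Z}$ continuous. Strings in $\Omega(\xi_{\mathrm{Mu}})$ have no double letters ($aa,cc,dd$ are not subwords). For $z\in\{a,c,d\}$, the map $\delta_z:\Omega(\xi_{\mathrm{Mu}})\to\Omega(\xi_{\mathrm{Mu}})$ is defined for $\omega=\ldots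 x_{-1}x_0.x_1x_2\ldots$ by $\delta_z(\omega)=\sigma(\omega)$ if $x_1=z$, $\delta_z(\omega)=\sigma^{-1}(\omega)$ if $x_0=z$, and $\delta_z(\omega)=\omega$ otherwise; it is an involution in $[[\sigma|\Omega(\xi_{\mathrm{Mu}})]]$. Growth: for an infinite group $G$ with finite generating set $A$, $\gamma_{G,A}(n)$ is the number of elements of $G$ that can be written as a product of at most $n$ elements of $A$ and their inverses. $G$ has intermediate growth if for all $c>1$ and $\alpha>0$ one has $n^\alpha<\gamma_{G,A}(n)<c^n$ for all sufficiently large $n$ (this does not depend on the choice of $A$). *)

(* Defs.v *)
From HB Require Import structures.
From mathcomp Require Import all_boot all_order all_algebra finmap.
From mathcomp Require Import all_classical all_reals all_analysis.

Set Implicit Arguments.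
Unset Strict Implicit.
Unset Printing Implicit Defensive.

Import Order.TTheory GRing.Theory Num.Theory.
Import numFieldNormedType.Exports.

Local Open Scope classical_set_scope.

Section GroupGrowth.
Variable G : groupType.
Local Open Scope group_scope.

Definition generated (A : set G) : set G :=
  smallest [set H : set G | group_closed (mem H)] A.

Definition word_ball (A : set G) (n : nat) : set G :=
  [set g | exists s : seq G,
    [/\ (size s <= n)%N, (forall x, x \in s -> A x \/ A x^-1)
      & g = \prod_(x <- s) x]].

(* [fset_set] is junk on infinite sets, but [word_ball A n] is finite as soon
   as [A] is. *)
Definition growth (A : set G) (n : nat) : nat := #|` fset_set (word_ball A n)|.

Definition intermediate_growth (R : realType) (H : set G) : Prop :=
  [/\ infinite_set H,
      exists A, finite_set A /\ generated A = H
    & forall A, finite_set A -> generated A = H ->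
      forall c alpha : R, (1 < c)%R -> (0 < alpha)%R ->
        \forall n \near \oo,
          (n%:R `^ alpha < (growth A n)%:R < c ^+ n)%R].

Definition expgz (x : G) (k : int) : G :=
  match k with Posz n => x ^+ n | Negz n => x ^- n.+1 end.

Lemma expgz_nat_sub (x : G) (m n : nat) :
  expgz x (m%:Z - n%:Z)%R = x ^+ m * x ^- n.
Proof.
have [nm|/ltnW mn] := leqP n m; first by rewrite subzn // -expgnFr.
rewrite -opprB subzn // -[x ^+ m]invgK -invgM -expgnFr //.
by case: (n - m)%N => [|k]; rewrite ?invg1.
Qed.

Lemma expgzD (x : G) (k l : int) : expgz x (k + l)%R = expgz x k * expgz x l.
Proof.
have split_int (i : int) : exists m n : nat, i = (m%:Z - n%:Z)%R.
  case: i => n; first by exists n, 0; rewrite subr0.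
  by exists 0, n.+1; rewrite sub0r NegzE.
have [m [n ->]] := split_int k; have [p [q ->]] := split_int l.
have -> : (m%:Z - n%:Z + (p%:Z - q%:Z) = (m + p)%N%:Z - (n + q)%N%:Z)%R.
  by rewrite !PoszD opprD addrACA.
rewrite !expgz_nat_sub expgnDr addnC expgnDr invgM -!mulgA; congr (_ * _).
rewrite !mulgA; congr (_ * _).
by apply/commuteV/commuteX/commute_sym/commuteX.
Qed.

Lemma expgzN (x : G) (k : int) : expgz x (- k)%R = (expgz x k)^-1.
Proof. by rewrite (mulg1_eq _ (y := expgz x (- k)%R)) // -expgzD subrr. Qed.

End GroupGrowth.

Record homeo (X : topologicalType) := Homeo {
  homeo_fun :> X -> X;
  homeo_inv : X -> X;
  homeo_continuous : continuous homeo_fun;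
  homeo_inv_continuous : continuous homeo_inv;
  homeoK : cancel homeo_fun homeo_inv;
  homeoVK : cancel homeo_inv homeo_fun }.

HB.instance Definition _ (X : topologicalType) := gen_eqMixin (homeo X).
HB.instance Definition _ (X : topologicalType) := gen_choiceMixin (homeo X).

Section HomeoGroup.
Variable X : topologicalType.
Implicit Types F G H : homeo X.

Lemma homeo_ext F G : F =1 G -> F = G.
Proof.
case: F G => [f f' cf cf' fK f'K] [g g' cg cg' gK g'K] /= /funext fg.
have f'g' : f' = g' by apply/funext => x; rewrite -{1}(g'K x) -fg fK.
case: g / fg cg gK g'K => cg gK g'K.
case: g' / f'g' cg' gK g'K => cg' gK g'K.
by congr Homeo; exact: Prop_irrelevance.
Qed.

Definition homeo_one : homeo X :=
  @Homeo X id id (fun x => cvg_id) (fun x => cvg_id) (frefl id) (frefl id).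

Definition homeo_invg F : homeo X :=
  Homeo (@homeo_inv_continuous _ F) (@homeo_continuous _ F)
    (@homeoVK _ F) (@homeoK _ F).

Lemma continuous_comp_fun (f g : X -> X) :
  continuous f -> continuous g -> continuous (f \o g).
Proof. by move=> cf cg x; apply: continuous_comp; [exact: cg|exact: cf]. Qed.

Definition homeo_mul F G : homeo X :=
  Homeo (continuous_comp_fun (@homeo_continuous _ F) (@homeo_continuous _ G))
    (continuous_comp_fun (@homeo_inv_continuous _ G) (@homeo_inv_continuous _ F))
    (can_comp (@homeoK _ F) (@homeoK _ G))
    (can_comp (@homeoVK _ G) (@homeoVK _ F)).

Lemma homeo_mulA : associative homeo_mul.
Proof. by move=> F G H; exact: homeo_ext. Qed.

Lemma homeo_mul1 : left_id homeo_one homeo_mul.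
Proof. by move=> F; exact: homeo_ext. Qed.

Lemma homeo_mulr1 : right_id homeo_one homeo_mul.
Proof. by move=> F; exact: homeo_ext. Qed.

Lemma homeo_mulV : left_inverse homeo_one homeo_invg homeo_mul.
Proof. by move=> F; apply: homeo_ext => x /=; rewrite homeoK. Qed.

Lemma homeo_mulrV : right_inverse homeo_one homeo_invg homeo_mul.
Proof. by move=> F; apply: homeo_ext => x /=; rewrite homeoVK. Qed.

HB.instance Definition _ := isGroup.Build (homeo X)
  homeo_mulA homeo_mul1 homeo_mulr1 homeo_mulV homeo_mulrV.

Variable T : homeo X.

Definition is_cocycle (nu : X -> discrete_topology int) (f : X -> X) :=
  continuous nu /\ forall x, f x = expgz T (nu x) x.

Definition in_tfg : pred (homeo X) := fun F => `[< exists nu, is_cocycle nu F >].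

Lemma continuous_locally_constant (Y : topologicalType) (D : choiceType)
    (f : Y -> discrete_topology D) :
  (forall y, \forall z \near y, f z = f y) <-> continuous f.
Proof.
split=> fc y; first by apply/discrete_cvg; exact: fc.
by have /discrete_cvg := fc y.
Qed.

Lemma is_cocycle_continuous nu (f : X -> X) : is_cocycle nu f -> continuous f.
Proof.
move=> [/continuous_locally_constant nuc fE] x.
rewrite /continuous_at fE.
apply: cvg_trans (@homeo_continuous _ (expgz T (nu x)) x).
apply: near_eq_cvg; near=> y; rewrite fE.
by congr (homeo_fun (expgz T _) _); apply/esym; near: y; exact: nuc.
Unshelve. all: by end_near. Qed.

Lemma in_tfg_group_closed : group_closed in_tfg.
Proof.
split.
  apply/asboolP; exists (fun=> 0%R); split=> // x; exact: cst_continuous.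
move=> F G /asboolP[nu [nuc FE]] /asboolP[mu [muc GE]]; apply/asboolP.
exists (fun x => nu (homeo_inv G x) - mu (homeo_inv G x) : int)%R; split.
  apply/continuous_locally_constant => x.
  move/continuous_locally_constant/(_ (homeo_inv G x)): nuc => nuc.
  move/continuous_locally_constant/(_ (homeo_inv G x)): muc => muc.
  have GVc P : nbhs (homeo_inv G x) P -> nbhs x (homeo_inv G @^-1` P).
    exact: (@homeo_inv_continuous _ G x).
  have := GVc _ muc; have := GVc _ nuc; apply: filterS2 => y /= nuE muE.
  by rewrite nuE muE.
move=> x; rewrite expgzD expgzN /= FE.
have E : homeo_inv (expgz T (mu (homeo_inv G x))) x = homeo_inv G x.
  by rewrite -{2}(homeoVK G x) GE homeoK.
by rewrite -{2}E.
Qed.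

Record tfg := Tfg { tfg_val :> homeo X; _ : in_tfg tfg_val }.

HB.instance Definition _ := [isSub for tfg_val].
HB.instance Definition _ := [Choice of tfg by <:].
HB.instance Definition _ :=
  SubChoice_isSubGroup.Build (homeo X) in_tfg tfg in_tfg_group_closed.

End HomeoGroup.

Inductive letter := la | lc | ld.

Definition letter_code (l : letter) : nat :=
  match l with la => 0 | lc => 1 | ld => 2 end.
Definition letter_decode (n : nat) : letter :=
  match n with 0 => la | 1 => lc | _ => ld end.
Lemma letter_codeK : cancel letter_code letter_decode.
Proof. by case. Qed.

HB.instance Definition _ := Countable.copy letter (can_type letter_codeK).

Definition substitution (l : letter) : seq letter :=
  match l with la => [:: la; lc; la] | lc => [:: ld] | ld => [:: lc] end.

Definition subst_word (w : seq letter) : seq letter :=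
  flatten (map substitution w).

(* [subst_string xi eta]: applying the substitution to the infinite string
   [xi] gives [eta].  Infinite strings are indexed from 0 rather than from 1. *)
Definition subst_string (xi eta : nat -> letter) : Prop :=
  forall n, let w := subst_word (mkseq xi n) in w = mkseq eta (size w).

Definition is_xi_Mu (xi : nat -> letter) : Prop :=
  xi 0 = la /\ subst_string xi xi.

Lemma size_subst_word w : (size w <= size (subst_word w))%N.
Proof.
elim: w => // l w IH; rewrite /subst_word /= size_cat.
by case: l => /=; rewrite ?addSn ?add0n ?ltnS //; do 2!apply: leqW.
Qed.

Lemma subst_word_cat u v : subst_word (u ++ v) = subst_word u ++ subst_word v.
Proof. by rewrite /subst_word map_cat flatten_cat. Qed.

Lemma mkseq_take (T : Type) (f : nat -> T) m n :
  (m <= n)%N -> mkseq f m = take m (mkseq f n).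
Proof. by move=> mn; rewrite /mkseq -map_take take_iota (minn_idPl mn). Qed.

Lemma size_subst_a xi n : xi 0 = la ->
  (n.+2 < size (subst_word (mkseq xi n.+1)))%N.
Proof.
move=> xi0; rewrite /mkseq /= xi0 /subst_word /= !ltnS.
by rewrite (leq_trans _ (size_subst_word _)) // size_map size_iota.
Qed.

Lemma is_xi_Mu_unique xi eta : is_xi_Mu xi -> is_xi_Mu eta -> xi = eta.
Proof.
move=> [xi0 xiS] [eta0 etaS]; apply/funext => i.
suff /(congr1 (fun s => nth la s i)) : mkseq xi i.+1 = mkseq eta i.+1.
  by rewrite !nth_mkseq.
elim: i => [|i IH]; first by rewrite /mkseq /= xi0 eta0.
have := xiS i.+1; rewrite IH /= [LHS](etaS i.+1) /= => E.
have lei : (i.+2 <= size (subst_word (mkseq eta i.+1)))%N.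
  exact/ltnW/size_subst_a.
by rewrite (mkseq_take xi lei) (mkseq_take eta lei) -E.
Qed.

Definition xi_iter (k : nat) : seq letter := iter k subst_word [:: la].

Lemma xi_iter_prefix k : exists w, xi_iter k.+1 = xi_iter k ++ w.
Proof.
elim: k => [|k [w IH]]; first by exists [:: lc; la].
by exists (subst_word w); rewrite -subst_word_cat -IH.
Qed.

Lemma xi_iter_mono j k : (j <= k)%N -> exists w, xi_iter k = xi_iter j ++ w.
Proof.
move=> /subnK <-; elim: (k - j)%N => [|i [w IH]].
  by exists [::]; rewrite cats0.
by have [v ->] := xi_iter_prefix (i + j); rewrite IH -catA; exists (w ++ v).
Qed.

Lemma size_xi_iter k : (k < size (xi_iter k))%N.
Proof.
have head_a j : exists w, xi_iter j = la :: w by exact: (xi_iter_mono (leq0n j)).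
elim: k => // k IH; rewrite /xi_iter iterS -/(xi_iter k).
have [w E] := head_a k; rewrite E in IH *; rewrite /subst_word /= !ltnS.
by rewrite ltnS in IH; apply: leqW; rewrite (leq_trans IH) ?size_subst_word.
Qed.

Lemma is_xi_Mu_exists : exists xi, is_xi_Mu xi.
Proof.
pose xi n := nth la (xi_iter n) n.
have xiE k : xi_iter k = mkseq xi (size (xi_iter k)).
  apply: (@eq_from_nth _ la); rewrite ?size_mkseq // => i ik.
  rewrite nth_mkseq // /xi; have [ki|/ltnW ki] := leqP k i.
    by have [w ->] := xi_iter_mono ki; rewrite nth_cat ik.
  by have [w ->] := xi_iter_mono ki; rewrite nth_cat size_xi_iter.
exists xi; split=> // n w.
have nk := ltnW (size_xi_iter n).
have E : xi_iter n.+1 = w ++ subst_word (drop n (xi_iter n)).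
  rewrite {1}/xi_iter iterS -/(xi_iter n) -{1}(cat_take_drop n (xi_iter n)).
  by rewrite subst_word_cat {1}xiE -(mkseq_take _ nk).
have sw : (size w <= size (xi_iter n.+1))%N by rewrite E size_cat leq_addr.
by rewrite (mkseq_take _ sw) -xiE E take_size_cat.
Qed.

(* [w 0] and [w 1] are the letters on either side of the dot. *)
Definition bistring := {ptws int -> discrete_topology letter}.

Definition subword (xi : nat -> letter) (u : seq letter) : Prop :=
  exists i : nat, u = mkseq (fun j => xi (i + j)%N) (size u).

Definition bisubword (w : bistring) (u : seq letter) : Prop :=
  exists i : int, u = mkseq (fun j => w (i + j%:Z)%R) (size u).

Definition xi_Mu : nat -> letter := sval (cid is_xi_Mu_exists).

Definition Omega : set bistring :=
  [set w | forall u, u != [::] -> bisubword w u -> subword xi_Mu u].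

Definition bishift (k : int) (w : bistring) : bistring := fun n => w (n + k)%R.

Lemma bishift_Omega k w : Omega w -> Omega (bishift k w).
Proof.
move=> wO u u0 [i uE]; apply: wO => //; exists (i + k)%R.
by rewrite {1}uE; apply: eq_mkseq => j; rewrite /bishift addrAC.
Qed.

Definition Omega_shift (k : int) (w : Omega) : Omega :=
  SigSub (mem_set (@bishift_Omega k _ (set_valP w))).

Lemma Omega_shift_comp k l w :
  Omega_shift k (Omega_shift l w) = Omega_shift (l + k)%R w.
Proof.
apply/val_inj/funext => n /=.
by rewrite /Omega_shift /bishift /= -addrA (addrC k).
Qed.

Lemma Omega_shift0 w : Omega_shift 0%R w = w.
Proof. by apply/val_inj/funext => n; rewrite /= /bishift addr0. Qed.

Lemma Omega_coord_continuous (n : int) :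
  continuous (fun w : Omega => set_val w n).
Proof.
pose D := discrete_topology letter; move=> w.
have sc : {for w, continuous (set_val : Omega -> bistring)}.
  exact: initial_continuous.
exact: (continuous_comp sc (@proj_continuous int (fun=> D) n (set_val w))).
Qed.

Lemma continuous_Omega (Y : topologicalType) (f : Y -> Omega) :
  (forall n, continuous (fun y => set_val (f y) n)) -> continuous f.
Proof.
move=> fc; apply: continuous_comp_initial => y; apply/cvg_sup => n.
by apply: (@continuous_comp_initial _ _ _ (fun g : bistring => g n)); exact: fc.
Qed.

Lemma Omega_shift_continuous k : continuous (Omega_shift k).
Proof. by apply: continuous_Omega => n; exact: Omega_coord_continuous. Qed.

Lemma Omega_shiftK k : cancel (Omega_shift k) (Omega_shift (- k)%R).
Proof. by move=> w; rewrite Omega_shift_comp subrr Omega_shift0. Qed.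

Lemma Omega_shiftVK k : cancel (Omega_shift (- k)%R) (Omega_shift k).
Proof. by move=> w; rewrite Omega_shift_comp addNr Omega_shift0. Qed.

Definition sigma : homeo Omega :=
  Homeo (@Omega_shift_continuous 1%R) (@Omega_shift_continuous (- 1)%R)
    (@Omega_shiftK 1%R) (@Omega_shiftVK 1%R).

Definition delta_fun (z : letter) (w : Omega) : Omega :=
  if set_val w 1%R == z then sigma w
  else if set_val w 0%R == z then homeo_inv sigma w
  else w.

Definition class_neq (x y : letter) := (x == la) != (y == la).

Lemma subst_word_alternating x w : path class_neq x w ->
  path class_neq (last x (substitution x)) (subst_word w).
Proof.
by elim: w x => //= y w IH x /andP[xy /IH]; rewrite cat_path; case: x xy; case: y.
Qed.

Lemma xi_Mu_no_double n : xi_Mu n != xi_Mu n.+1.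
Proof.
have [xi0 xiS] : is_xi_Mu xi_Mu by exact: svalP (cid is_xi_Mu_exists).
have iterE k : xi_iter k = mkseq xi_Mu (size (xi_iter k)).
  elim: k => [|k IH]; first by rewrite /mkseq /= xi0.
  by rewrite /xi_iter iterS -/(xi_iter k) IH; exact: xiS.
have alt k : sorted class_neq (xi_iter k).
  elim: k => // k; rewrite /xi_iter iterS -/(xi_iter k).
  have [w ->] := xi_iter_mono (leq0n k).
  by move=> /subst_word_alternating /=.
have nk : (n.+1 < size (xi_iter n.+1))%N by exact: size_xi_iter.
have /(sortedP la)/(_ n nk) := alt n.+1.
rewrite iterE !nth_mkseq //; last exact: ltnW.
by apply: contraNneq => ->.
Qed.

Lemma Omega_no_double (w : Omega) i : set_val w i != set_val w (i + 1)%R.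
Proof.
have [//||j] := set_valP w [:: set_val w i; set_val w (i + 1)%R].
  by exists i; rewrite /mkseq /= addr0.
rewrite /mkseq /= addn0 addn1 => -[-> ->]; exact: xi_Mu_no_double.
Qed.

Lemma delta_funK z : involutive (delta_fun z).
Proof.
move=> w; rewrite {2}/delta_fun; case: ifP => [w1|w1].
  have E1 : set_val (sigma w) 1%R = set_val w (1 + 1)%R by [].
  have E0 : set_val (sigma w) 0%R = set_val w 1%R by [].
  have := Omega_no_double w 1%R; rewrite (eqP w1) eq_sym => /negPf w2.
  by rewrite /delta_fun E1 E0 w2 w1 homeoK.
case: ifP => [w0|w0]; last by rewrite /delta_fun w1 w0.
have E1 : set_val (homeo_inv sigma w) 1%R = set_val w 0%R by [].
by rewrite /delta_fun E1 w0 homeoVK.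
Qed.

Lemma delta_fun_cocycle z : exists nu, is_cocycle sigma nu (delta_fun z).
Proof.
exists (fun w => if set_val w 1%R == z then 1%R
  else if set_val w 0%R == z then (- 1)%R else 0%R); split.
  apply/continuous_locally_constant => w.
  have /continuous_locally_constant/(_ w) := @Omega_coord_continuous 0%R.
  have /continuous_locally_constant/(_ w) := @Omega_coord_continuous 1%R.
  by apply: filterS2 => y /= -> ->.
move=> w; rewrite /delta_fun; case: ifP => // _.
by case: ifP => // _; rewrite expgzN.
Qed.

Lemma delta_fun_continuous z : continuous (delta_fun z).
Proof.
by have [nu nuP] := delta_fun_cocycle z; exact: is_cocycle_continuous nuP.
Qed.

Definition delta_homeo (z : letter) : homeo Omega :=
  Homeo (@delta_fun_continuous z) (@delta_fun_continuous z)
    (@delta_funK z) (@delta_funK z).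

Lemma delta_in_tfg z : in_tfg sigma (delta_homeo z).
Proof. by apply/asboolP; exact: delta_fun_cocycle. Qed.

Definition delta (z : letter) : tfg sigma := Tfg (delta_in_tfg z).

(* Main.v *)
(**
A word in [delta_a], [delta_c], [delta_d] acts on a half-line of positions
[0, 1, 2, ...] whose edge between [p - 1] and [p] carries the [p]-th letter of
[xi_Mu]: [a] if [p] is odd, and otherwise [c] or [d] according to the parity of
the 2-adic valuation of [p].  Gray-coding the positions by binary sequences turns
this into the self-similar action [a = swap], [c = (a, d)], [d = (1, c)].

Upper bound: with [b = c d], a reduced word alternates between [a] and
[b, c, d].  With the weights 2, 3, 2 for [a, c, d] the total weight of the two
sections of a reduced word drops by at least the number of its isolated [c]'s
and [d]'s, up to an additive constant.  Reduced words with a small proportion of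
these letters are few, because [b] leaves no choice; any other element is
determined by a pair of elements whose total weight is at most a fixed fraction
of its own.  So an exponential bound [C^n] on the growth improves step by step
to [(1 + eps)^n].

Lower bound: the substitution itself takes [u] to a word with sections [u] and,
when [u] is balanced, the identity.  Hence two sets of balanced words combine
into one realizing all pairs of sections, and words of length [O(8^k)] represent
[2^(2^k)] distinct elements.
*)
Require Import Defs.
From mathcomp Require Import all_boot all_order all_algebra finmap zify ring lra.
From mathcomp Require Import all_classical all_reals all_analysis.

Set Implicit Arguments.
Unset Strict Implicit.
Unset Printing Implicit Defensive.

Import Order.TTheory GRing.Theory Num.Theory.

Local Open Scope classical_set_scope.

(** * The Toeplitz structure of the fixed point *)

(* [xi_Mu] read with indices starting from 1; the junk value [toeplitz 0 = ld] is
   also the central letter of [omega0] below. *)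
Definition toeplitz (p : nat) : letter :=
  if odd p then la else if odd (logn 2 p) then lc else ld.

Definition shift_letter (z : letter) : letter :=
  match z with la => lc | lc => ld | ld => lc end.

Lemma toeplitz_odd p : odd p -> toeplitz p = la.
Proof. by move=> p_odd; rewrite /toeplitz p_odd. Qed.

Lemma toeplitz_double m :
  (0 < m)%N -> toeplitz m.*2 = shift_letter (toeplitz m).
Proof.
move=> m_gt0; rewrite /toeplitz odd_double -mul2n lognM // logn_prime //=.
case: (boolP (odd m)) => [m_odd|_]; last by case: (odd (logn 2 m)).
by rewrite logn_coprime // coprime2n.
Qed.

Lemma toeplitz_even p : ~~ odd p -> toeplitz p != la.
Proof. by move=> /negPf p_even; rewrite /toeplitz p_even; case: ifP. Qed.

(** By uniqueness of the fixed point. Counting from 1, odd places carry [la], which expands to three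
    letters, and even places expand to one; hence the length [n./2 * 4 + odd n * 3]. *)
Lemma xi_MuE n : xi_Mu n = toeplitz n.+1.
Proof.
suff -> : xi_Mu = toeplitz \o S by [].
move: n => _.
apply: is_xi_Mu_unique; first exact: svalP (cid is_xi_Mu_exists).
split=> // n w; rewrite {}/w.
suff [E1 E2] : subst_word (mkseq (toeplitz \o S) n)
    = mkseq (toeplitz \o S) (n./2 * 4 + odd n * 3) /\
    size (subst_word (mkseq (toeplitz \o S) n)) = (n./2 * 4 + odd n * 3)%N.
  by rewrite E2 E1.
suff E : subst_word (mkseq (toeplitz \o S) n)
    = mkseq (toeplitz \o S) (n./2 * 4 + odd n * 3).
  by rewrite E size_mkseq.
elim: n => // n IH; rewrite {1}/mkseq -addn1 iotaD map_cat subst_word_cat.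
rewrite -/(mkseq _ n) IH add0n addn1 /subst_word /= cats0 uphalf_half.
have sub1 z : z != la -> substitution z = [:: shift_letter z] by case: z.
case: (boolP (odd n)) => n_odd /=.
  have -> : n = n./2.*2.+1 by lia.
  move: n./2 => m.
  have -> : (m.*2.+1./2 * 4 + 1 * 3 = m * 4 + 3)%N by lia.
  have -> : ((1 + m.*2.+1./2) * 4 + 0 * 3 = (m * 4 + 3).+1)%N by lia.
  rewrite sub1 ?toeplitz_even /= ?odd_double // mkseqS -cats1 /=.
  by rewrite -toeplitz_double //; congr (_ ++ [:: toeplitz _]); lia.
have -> : n = n./2.*2 by lia.
move: n./2 => m; rewrite doubleK.
have -> : ((0 + m) * 4 + 1 * 3 = (m * 4).+3)%N by lia.
rewrite mul0n addn0 !mkseqS -!cats1 -!catA /=; congr (_ ++ _).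
have -> : (m * 4).+2 = m.*2.+1.*2 by lia.
rewrite toeplitz_double // !(@toeplitz_odd (_.+1)) /= ?odd_double //; lia.
Qed.

(** * The self-similar action on positions *)

(* No letter sits on the edge at [0], so [0] has no left neighbour. *)
Definition move (z : letter) (p : nat) : nat :=
  if toeplitz p.+1 == z then p.+1
  else if (0 < p)%N && (toeplitz p == z) then p.-1 else p.

Definition act (u : seq letter) (p : nat) : nat := foldr move p u.

Lemma act_cat u v p : act (u ++ v) p = act u (act v p).
Proof. exact: foldr_cat. Qed.

Lemma move_double z m : move z m.*2 =
  if z == la then m.*2.+1
  else if (0 < m)%N && (shift_letter (toeplitz m) == z) then m.*2.-1 else m.*2.
Proof.
rewrite /move toeplitz_odd /= ?odd_double // eq_sym; case: eqP => // _.
by rewrite double_gt0; case: m => //= m; rewrite toeplitz_double.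
Qed.

Lemma move_doubleS z m : move z m.*2.+1 =
  if z == la then m.*2
  else if shift_letter (toeplitz m.+1) == z then m.*2.+2 else m.*2.+1.
Proof.
rewrite /move -doubleS toeplitz_double // (@toeplitz_odd m.*2.+1) /= ?odd_double //.
rewrite (eq_sym la); case: (eqVneq z la) => [->|] //.
by case: (toeplitz _).
Qed.

Lemma double_or p : exists m, p = m.*2 \/ p = m.*2.+1.
Proof. by exists p./2; case: (boolP (odd p)) => p_odd; [right|left]; lia. Qed.

Lemma moveK z : involutive (move z).
Proof.
move=> p; have [m [->|->]] := double_or p.
- rewrite move_double; case: ifP => [z_a|z_a]; first by rewrite move_doubleS z_a.
  case: ifP => [/andP[m_gt0 tz]|tz]; last by rewrite move_double z_a tz.
  by case: m m_gt0 tz => // m _ tz; rewrite doubleS /= move_doubleS z_a tz.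
- rewrite move_doubleS; case: ifP => [z_a|z_a]; first by rewrite move_double z_a.
  case: ifP => tz; last by rewrite move_doubleS z_a tz.
  by rewrite -doubleS move_double z_a tz.
Qed.

(** At each position at most one edge carries [lc] or [ld], since odd edges carry [la]; the other of
    the two letters fixes both ends of that edge. *)
Lemma move_cd p : move lc (move ld p) = move ld (move lc p).
Proof.
have [m [->|->]] := double_or p.
- rewrite !move_double /=; case: m => [|m] //=.
  by rewrite doubleS /=; case E: (toeplitz m.+1);
     rewrite /= -?doubleS ?move_double ?move_doubleS ?E.
- rewrite !move_doubleS /=.
  by case E: (toeplitz m.+1); rewrite /= -?doubleS ?move_double ?move_doubleS ?E.
Qed.

(* First letter of the Gray code of a position; the rest is the code of [p./2]. *)
Definition digit (p : nat) : bool := odd p (+) odd p./2.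

(** The recursion [c = (a, d)], [d = (1, c)], with the first coordinate at digit [true]. *)
Definition section1 (x : bool) (z : letter) : seq letter :=
  match z, x with
  | la, _ => [::] | lc, true => [:: la] | lc, false => [:: ld]
  | ld, true => [::] | ld, false => [:: lc]
  end.

Lemma digit_move z p : digit (move z p) = digit p (+) (z == la).
Proof.
rewrite /digit; have [m [->|->]] := double_or p.
- rewrite move_double; case: eqP => _; first by
    rewrite /= uphalf_double doubleK odd_double addbC addbT.
  rewrite addbF; case: ifP => // /andP[]; case: m => // m _ _.
  by rewrite doubleS /= uphalf_double doubleK odd_double /=; case: odd.
- rewrite move_doubleS /= uphalf_double; case: eqP => _.
    by rewrite odd_double doubleK addbT /= negbK.
  by case: ifP; rewrite addbF -?doubleS ?doubleK /= ?uphalf_double odd_double //= negbK.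
Qed.

(** Halving collapses the edges carrying [la] and turns the edge [m.*2] into the edge [m]. The digit
    is [true] exactly when this halved edge carries [la]. *)
Lemma half_move z p : (move z p)./2 = act (section1 (digit p) z) p./2.
Proof.
rewrite /digit; have [m [->|->]] := double_or p.
- rewrite move_double doubleK odd_double /=.
  case: z => /=; first by rewrite uphalf_double.
  + case: (boolP (odd m)) => m_odd /=.
      rewrite (@toeplitz_odd m) //= /move (@toeplitz_odd m) //.
      have /negPf -> : toeplitz m.+1 != la by rewrite toeplitz_even //= m_odd.
      by case: m m_odd => // m _ /=; rewrite uphalf_double.
    rewrite /move (@toeplitz_odd m.+1) //=; case: m m_odd => //= m m_even.
    have : toeplitz m.+1 != la by rewrite toeplitz_even.
    by case: (toeplitz _) => //= _; rewrite ?uphalf_double ?doubleK.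
  + case: (boolP (odd m)) => m_odd /=.
      by rewrite (@toeplitz_odd m) //= andbF doubleK.
    rewrite /move (@toeplitz_odd m.+1) //=; case: m m_odd => //= m m_even.
    have : toeplitz m.+1 != la by rewrite toeplitz_even.
    by case: (toeplitz _) => //= _; rewrite ?uphalf_double ?doubleK.
- rewrite move_doubleS /= uphalf_double odd_double /=.
  case: z => /=; first by rewrite doubleK.
  + case: (boolP (odd m)) => m_odd /=.
      rewrite /move (@toeplitz_odd m) // andbF.
      have : toeplitz m.+1 != la by rewrite toeplitz_even //= m_odd.
      by case: (toeplitz _) => //= _; rewrite ?uphalf_double ?doubleK.
    by rewrite /move (@toeplitz_odd m.+1) //= doubleK.
  + case: (boolP (odd m)) => m_odd /=.
      rewrite /move (@toeplitz_odd m) // andbF.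
      have : toeplitz m.+1 != la by rewrite toeplitz_even //= m_odd.
      by case: (toeplitz _) => //= _; rewrite ?uphalf_double ?doubleK.
    by rewrite (@toeplitz_odd m.+1) //= uphalf_double.
Qed.

Definition parity (u : seq letter) : bool := odd (count_mem la u).

Fixpoint section (x : bool) (u : seq letter) : seq letter :=
  if u is z :: v then section1 (x (+) parity v) z ++ section x v else [::].

Lemma parity_cat u v : parity (u ++ v) = parity u (+) parity v.
Proof. by rewrite /parity count_cat oddD. Qed.

Lemma section_cat x u v :
  section x (u ++ v) = section (x (+) parity v) u ++ section x v.
Proof.
by elim: u => //= z u ->; rewrite catA parity_cat -addbA (addbC (parity v)).
Qed.

Lemma digit_act u p : digit (act u p) = digit p (+) parity u.
Proof.
elim: u => [|z u IH] /=; first by rewrite addbF.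
by rewrite digit_move IH /parity /= oddD -addbA (addbC (odd _)) oddb.
Qed.

Lemma half_act u p : (act u p)./2 = act (section (digit p) u) p./2.
Proof.
by elim: u => //= z u IH; rewrite half_move act_cat digit_act IH.
Qed.

Definition undigit (x : bool) (m : nat) : nat := (x (+) odd m + m.*2)%N.

Lemma undigitK p : undigit (digit p) p./2 = p.
Proof. by rewrite /undigit /digit addbK odd_double_half. Qed.

Lemma half_undigit x m : (undigit x m)./2 = m.
Proof. by rewrite /undigit half_bit_double. Qed.

Lemma digit_undigit x m : digit (undigit x m) = x.
Proof.
by rewrite /digit half_undigit /undigit oddD odd_double addbF oddb addbK.
Qed.

Lemma act_undigit u x m :
  act u (undigit x m) = undigit (x (+) parity u) (act (section x u) m).
Proof.
rewrite -[LHS]undigitK half_act digit_act digit_undigit half_undigit //.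
Qed.

(** * Contraction of reduced words *)

Inductive block := Bb | Bc | Bd.

(* [Bb] stands for the product of [lc] and [ld]. *)
Definition spell_block (y : block) : seq letter :=
  match y with Bb => [:: lc; ld] | Bc => [:: lc] | Bd => [:: ld] end.

Definition spell_blocks (ys : seq block) : seq letter :=
  flatten [seq la :: spell_block y | y <- ys].

(** Normal form in the free product of the two-element group of [la] and the four-group of [lc] and
    [ld]. *)
Definition spell (x : option block) (ys : seq block) (t : bool) : seq letter :=
  oapp spell_block [::] x ++ spell_blocks ys ++ nseq t la.

(* Weights for which one level of sections already contracts: an isolated
   [lc] (with its [la]) goes from 5 to 4, an isolated [ld] from 4 to 3, while
   [lc; ld] keeps 7. *)
Definition letter_weight (z : letter) : nat :=
  match z with la => 2 | lc => 3 | ld => 2 end.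

Definition weight (u : seq letter) : nat := sumn (map letter_weight u).

Lemma weight_cat u v : weight (u ++ v) = (weight u + weight v)%N.
Proof. by rewrite /weight map_cat sumn_cat. Qed.

(** Prepending a letter changes only the front of the normal form: the letters are involutions, and
    [lc] commutes with [ld]. *)
Lemma reduce_word u : exists x ys t,
  act (spell x ys t) = act u /\ (weight (spell x ys t) <= weight u)%N.
Proof.
elim: u => [|z u [x [ys [t [uE uw]]]]]; first by exists None, [::], false.
suff [x' [ys' [t' [E W]]]] : exists x' ys' t',
    act (spell x' ys' t') = move z \o act (spell x ys t) /\
    (weight (spell x' ys' t') <= letter_weight z + weight (spell x ys t))%N.
  exists x', ys', t'; rewrite E uE; split=> //.
  by rewrite (leq_trans W) // leq_add2l.
case: z; last 2 first.
- exists (match x with None => Some Bc | Some Bc => None | Some Bd => Some Bb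
    | Some Bb => Some Bd end), ys, t.
  case: x {uE uw} => [[]|] /=; split=> //; rewrite /spell /weight /=; try lia;
    by apply/funext => p; rewrite /act /= moveK.
- exists (match x with None => Some Bd | Some Bd => None | Some Bc => Some Bb
    | Some Bb => Some Bc end), ys, t.
  case: x {uE uw} => [[]|] /=; split=> //; rewrite /spell /weight /=; try lia;
    by apply/funext => p; rewrite /act /= -?move_cd ?moveK.
case: x uE uw => [y|] _ _; first by exists None, (y :: ys), t; rewrite /spell /= -catA.
case: ys => [|y ys].
  exists None, [::], (~~ t); case: t; split=> //.
  by apply/funext => p; rewrite /act /= moveK.
exists (Some y), ys, t; split; last first.
  by rewrite /spell /spell_blocks /= -catA /weight /=; lia.
by apply/funext => p; rewrite /spell /spell_blocks /= -catA /act /= moveK.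
Qed.

Definition section_weight (z : letter) : nat :=
  match z with la => 0 | lc => 4 | ld => 3 end.

Lemma weight_sections u :
  (weight (section true u) + weight (section false u))%N
  = sumn (map section_weight u).
Proof.
elim: u => //= z u IH; rewrite !weight_cat -IH.
by case: z; case: (parity u); rewrite /weight /=; lia.
Qed.

Definition cd_count (ys : seq block) : nat :=
  count (fun y => if y is Bb then false else true) ys.

(** The constant 2 pays for a first block, which has no [la] to offset it: [Bb] alone weighs 5 and
    its sections 7. *)
Lemma weight_sections_spell x ys t :
  (weight (section true (spell x ys t)) + weight (section false (spell x ys t))
   + cd_count ys <= weight (spell x ys t) + 2)%N.
Proof.
rewrite weight_sections /spell /weight !map_cat !sumn_cat.
have : (sumn (map section_weight (spell_blocks ys)) + cd_count ys <=
        sumn (map letter_weight (spell_blocks ys)))%N.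
  elim: ys => //= y ys IH; rewrite /spell_blocks /= !map_cat !sumn_cat.
  by rewrite -/(spell_blocks ys); case: y => /=; lia.
case: x => [[]|] /=; case: t => /=; lia.
Qed.

Lemma size_blocks_weight x ys t : (size ys <= weight (spell x ys t))%N.
Proof.
rewrite /spell !weight_cat; suff : (size ys <= weight (spell_blocks ys))%N by lia.
elim: ys => //= y ys IH; rewrite /spell_blocks /= -cat_cons weight_cat -/(spell_blocks ys).
suff : (0 < weight (la :: spell_block y))%N by lia.
by rewrite /weight.
Qed.

(** * Lists covering all words of bounded weight *)

Definition combine (x : bool) (f g : nat -> nat) (p : nat) : nat :=
  undigit (digit p (+) x) ((if digit p then f else g) p./2).

Lemma act_combine u :
  act u = combine (parity u) (act (section true u)) (act (section false u)).
Proof.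
by apply/funext => p; rewrite -{1}(undigitK p) act_undigit /combine; case: digit.
Qed.

Definition covers (L : seq (nat -> nat)) (n : nat) : Prop :=
  forall u, (weight u <= n)%N -> act u \in L.

(** At most [m] blocks, of which at most [k] are [Bc] or [Bd]. *)
Fixpoint block_lists (m k : nat) : seq (seq block) :=
  if m is m.+1 then
    [::] :: map (cons Bb) (block_lists m k) ++
    (if k is k.+1 then
       map (cons Bc) (block_lists m k) ++ map (cons Bd) (block_lists m k)
     else [::])
  else [:: [::]].

Definition reduced_acts (m k : nat) : seq (nat -> nat) :=
  [seq act (spell xt.1 ys xt.2)
     | xt <- [seq (x, t) | x <- [:: None; Some Bb; Some Bc; Some Bd],
                           t <- [:: true; false]],
       ys <- block_lists m k].

Lemma mem_reduced_acts m k x ys t : (size ys <= m)%N -> (cd_count ys <= k)%N ->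
  act (spell x ys t) \in reduced_acts m k.
Proof.
move=> ym yk.
suff [s1 [s2 E]] : exists s1 s2, block_lists m k = s1 ++ ys :: s2.
  rewrite /reduced_acts /=; case: x => [[]|]; case: t => /=; 
  rewrite E !map_cat /= !mem_cat !inE !eqxx ?orbT //.
elim: m k ys ym yk => [|m IH] k [|y ys] //=; first by exists [::], [::].
  by move=> _ _; exists [::]; eexists.
rewrite ltnS => ym yk.
have cat_mid (T : Type) (s1 s2 s3 s4 : seq T) z :
  exists r1 r2, s1 ++ (s2 ++ z :: s3) ++ s4 = r1 ++ z :: r2.
  by exists (s1 ++ s2), (s3 ++ s4); rewrite -!catA.
case: y yk => /= yk.
- have [s1 [s2 ->]] := IH k ys ym yk; rewrite map_cat /=.
  exact: (cat_mid _ [:: [::]]).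
- case: k yk => // k yk; have [s1 [s2 ->]] := IH k ys ym yk.
  by rewrite map_cat /= -cat_cons; apply: cat_mid.
- case: k yk => // k yk; have [s1 [s2 ->]] := IH k ys ym yk.
  rewrite [in X in _ ++ _ ++ X]map_cat /= -cat_cons catA.
  by rewrite -[_ ++ [seq _ | _ <- _] ++ _ :: _]cats0 -catA; apply: cat_mid.
Qed.

Definition split_acts (L : nat -> seq (nat -> nat)) (N : nat) :
    seq (nat -> nat) :=
  flatten [seq [seq combine xf.1 xf.2 g
     | xf <- [seq (x, f) | x <- [:: true; false], f <- L i], g <- L (N - i)%N]
     | i <- iota 0 N.+1].

Lemma mem_split_acts L N u : (forall n, covers (L n) n) ->
  (weight (section true u) + weight (section false u) <= N)%N ->
  act u \in split_acts L N.
Proof.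
move=> Lc uN; apply/flatten_mapP; exists (weight (section true u)).
  by rewrite mem_iota; lia.
rewrite act_combine; apply/allpairsP.
exists ((parity u, act (section true u)), act (section false u)); split=> //.
  apply/allpairsP; exists (parity u, act (section true u)); split=> //=.
    by rewrite !inE; case: parity.
  exact: Lc.
by apply: Lc; lia.
Qed.

(** Either at most [k] blocks are isolated letters and the word is listed directly, or the sections
    lose [k.+1] in weight, up to the constant 2, and determine the element together with its
    parity. *)
Lemma covers_split (L : nat -> seq (nat -> nat)) n k :
  (forall n, covers (L n) n) ->
  covers (reduced_acts n k ++ split_acts L (n + 2 - k.+1)) n.
Proof.
move=> Lc u un; have [x [ys [t [<- uw]]]] := reduce_word u.
rewrite mem_cat; case: (leqP (cd_count ys) k) => yk.
  by rewrite mem_reduced_acts //; have := size_blocks_weight x ys t; lia.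
rewrite mem_split_acts ?orbT //; have := weight_sections_spell x ys t; lia.
Qed.

(** * Subexponential upper bound *)

Local Open Scope ring_scope.

Lemma bernoulli_le (R : realFieldType) (x : R) n :
  0 <= x -> 1 + n%:R * x <= (1 + x) ^+ n.
Proof.
move=> x0; elim: n => [|n IH]; first by rewrite mul0r addr0.
have nx : 0 <= n%:R * x * x by rewrite !mulr_ge0.
rewrite exprS -natr1 (le_trans _ (ler_wpM2l _ IH)) //; lra.
Qed.

Lemma linear_le_expr (R : realFieldType) (c : R) :
  1 < c -> exists2 K, 0 <= K & forall n, n.+1%:R <= K * c ^+ n.
Proof.
move=> c1; have d0 : 0 < c - 1 by rewrite subr_gt0.
have K0 : 0 <= 1 + (c - 1)^-1 by rewrite addr_ge0 // invr_ge0 ltW.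
exists (1 + (c - 1)^-1) => // n.
have := ler_wpM2l K0 (bernoulli_le n (ltW d0)); rewrite subrKC.
apply: le_trans; set d := c - 1 in d0 *.
have -> : (1 + d^-1) * (1 + n%:R * d) = 1 + n%:R * d + d^-1 + n%:R :> R.
  by field; rewrite gt_eqF.
rewrite -natr1.
have : 0 <= n%:R * d by rewrite mulr_ge0 // ltW.
have : 0 <= d^-1 by rewrite invr_ge0 ltW.
lra.
Qed.

Lemma expr_unbounded (R : archiRealFieldType) (c x : R) :
  1 < c -> exists n, x <= c ^+ n.
Proof.
move=> c1; have d0 : 0 < c - 1 by rewrite subr_gt0.
have xd : 0 <= `|x| / (c - 1) by rewrite divr_ge0 // ltW.
have nP := archi_boundP xd; set n := Num.bound _ in nP.
exists n; have := bernoulli_le n (ltW d0); rewrite subrKC.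
apply: le_trans; rewrite ltr_pdivrMr // in nP.
have := ler_norm x; lra.
Qed.

Lemma exists_root (R : realType) (c : R) n :
  1 < c -> (0 < n)%N -> exists2 d, 1 < d & d ^+ n = c.
Proof.
move=> c1 n0; have E : (c `^ (n%:R^-1)) ^+ n = c.
  rewrite -powR_mulrn ?powR_ge0 // -powRrM mulVf ?pnatr_eq0 -?lt0n // powRr1 //.
  by rewrite ltW // (lt_trans _ c1).
exists (c `^ (n%:R^-1)) => //; rewrite ltNge; apply: contraTN c1 => d1.
by rewrite -leNgt -E exprn_ile1 // powR_ge0.
Qed.

(** Give each list the weight [y] to the number of its [Bc] and [Bd]. A list weighs at least
    [y ^+ k], and all lists of length [j] together at most [(1 + 2 * y) ^+ j]. *)
Lemma size_block_lists (R : realFieldType) (y : R) m k : 0 < y <= 1 ->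
  y ^+ k * (size (block_lists m k))%:R <= m.+1%:R * (1 + 2 * y) ^+ m.
Proof.
move=> /andP[y0 y1]; elim: m k => [|m IH] k /=.
  by rewrite mulr1 expr0 mul1r exprn_ile1 // ltW.
have c1 : 1 <= (1 + 2 * y) ^+ m.+1 by rewrite exprn_ege1 //; lra.
have yk1 j : y ^+ j <= 1 by rewrite exprn_ile1 // ltW.
rewrite size_cat size_map -natr1 natrD; case: k => [|k] /=.
  have := IH 0%N; rewrite !expr0 !mul1r => IH0.
  have : m.+1%:R * (1 + 2 * y) ^+ m <= m.+1%:R * (1 + 2 * y) ^+ m.+1.
    by rewrite ler_wpM2l // ler_weXn2l //; lra.
  by rewrite -[m.+2%:R]natr1; lra.
rewrite size_cat !size_map natrD.
have := IH k.+1; have := IH k; have := yk1 k.+1; move: c1.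
rewrite -[m.+2%:R]natr1 !exprS; set a := y ^+ k; set c := _ ^+ m.
set s := (size (block_lists m k.+1))%:R.
set s' := (size (block_lists m k))%:R => c1 a1 /= H1 H2.
have := ler_wpM2l (ltW y0) H1; lra.
Qed.

Lemma few_cd_acts (R : realType) (c : R) : 1 < c -> exists2 q, (0 < q)%N &
  exists K : R, forall n, (size (reduced_acts n (n %/ q)))%:R <= K * c ^+ n.
Proof.
(* Three factors [d ^+ n] are needed: for [y ^- k], for the power of [1 + 2 * y], and for [n.+1]. *)
move=> c1; have [d d1 <-] := @exists_root R c 3 c1 isT.
pose y := Num.min 1 ((d - 1) / 2).
have y01 : 0 < y <= 1 by rewrite lt_min ge_min lexx ltr01 andbT /=; lra.
have yd : 1 + 2 * y <= d.
  have : y <= (d - 1) / 2 by rewrite ge_min lexx orbT.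
  lra.
have [q qP] := expr_unbounded y^-1 d1.
have [K K0 KP] := linear_le_expr d1.
(* The 8 counts the choices of first block and last [la]. *)
exists q.+1 => //; exists (8 * K) => n.
have yq : 1 <= y * d ^+ q.+1.
  have /andP[y0 _] := y01.
  rewrite mulrC -ler_pdivrMr // div1r (le_trans qP) // ler_weXn2l //; exact: ltW.
rewrite /reduced_acts size_allpairs natrM -mulrA ler_wpM2l //.
have sn := size_block_lists n (n %/ q.+1) y01.
set k := (n %/ q.+1)%N in sn *; set s := (size (block_lists n k))%:R in sn *.
have s0 : 0 <= s by [].
have sd : s <= d ^+ (q.+1 * k) * (n.+1%:R * (1 + 2 * y) ^+ n).
  apply: le_trans (ler_wpM2l _ sn); last by rewrite exprn_ge0 //; lra.
  by rewrite exprM mulrA -exprMn mulrC ler_peMr // mulrC exprn_ege1.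
rewrite (le_trans sd) //.
have -> : K * (d ^+ 3) ^+ n = d ^+ n * (K * d ^+ n * d ^+ n).
  by rewrite exprAC; move: (d ^+ n) => t; ring.
apply: ler_pM.
- by rewrite exprn_ge0 //; lra.
- by rewrite mulr_ge0 // exprn_ge0 //; case/andP: y01; lra.
- by rewrite ler_weXn2l ?ltW // mulnC leq_divM.
apply: ler_pM => //; first by rewrite exprn_ge0 //; case/andP: y01; lra.
by rewrite lerXn2r // nnegrE; case/andP: y01; lra.
Qed.

Definition growth_bounded (R : realType) (c : R) : Prop :=
  exists K : R, exists L : nat -> seq (nat -> nat),
    forall n, covers (L n) n /\ (size (L n))%:R <= K * c ^+ n.

Lemma size_split_acts (R : realFieldType) L (K c : R) N :
  0 < c -> (forall n, (size (L n))%:R <= K * c ^+ n) ->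
  (size (split_acts L N))%:R <= N.+1%:R * (2 * (K ^+ 2 * c ^+ N)).
Proof.
move=> c0 LK.
rewrite /split_acts size_flatten /shape -map_comp sumnE big_map natr_sum.
rewrite -[iota _ _]/(index_iota 0 N.+1).
have -> : N.+1%:R * (2 * (K ^+ 2 * c ^+ N))
    = \sum_(0 <= i < N.+1) (2 * (K ^+ 2 * c ^+ N)).
  by rewrite sumr_const_nat subn0 mulr_natl.
apply: ler_sum_nat => i iN.
rewrite /comp size_allpairs natrM size_allpairs natrM -mulrA ler_wpM2l //.
have -> : c ^+ N = c ^+ i * c ^+ (N - i) by rewrite -exprD subnKC.
rewrite expr2 mulrACA ler_pM //.
Qed.

(** The saving [t.+1 * (n %/ q)] pays, up to [q.*2], for two excess copies of [n]: the explicit one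
    and the one from [t.+1] against [t]. *)
Lemma split_exponent_le n q t : (0 < q)%N -> (q.*2 <= t)%N ->
  (n + t.+1 * (n + 2 - (n %/ q).+1) <= t.+1 + q.*2 + t * n)%N.
Proof.
move=> q0 qt; have nq := ltn_pmod n q0; have nE := divn_eq n q.
have mn := leq_div n q; have tmn := leq_mul (leqnn t) mn.
move: (n %/ q)%N (n %% q)%N nq nE mn tmn => m r rq nE mn tmn.
have : (m * q.*2 <= m * t)%N by rewrite leq_mul2l qt orbT.
have -> : (n + 2 - m.+1 = n.+1 - m)%N by lia.
rewrite -muln2 mulnA mulnBr !mulSn (mulnS t n) (mulnC t m); lia.
Qed.

(** Exponents are measured in the unit [c]; splitting with [k = n %/ q] lowers the exponent by one.
    A factor [c ^+ n] absorbs the number of ways to share the weight between the sections. *)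
Lemma growth_bounded_step (R : realType) (c : R) q t : 1 < c -> (0 < q)%N ->
  (q.*2 <= t)%N ->
  (exists K : R, forall n, (size (reduced_acts n (n %/ q)))%:R <= K * c ^+ (t * n)) ->
  growth_bounded (c ^+ t.+1) -> growth_bounded (c ^+ t).
Proof.
move=> c1 q0 qt [K1 FK] [K [L LP]].
have [K2 K20 linP] := linear_le_expr c1.
have c0 : 0 < c by lra.
exists (K1 + 2 * K2 * (2 * (K ^+ 2 * c ^+ (t.+1 + q.*2)))).
exists (fun n => reduced_acts n (n %/ q) ++ split_acts L (n + 2 - (n %/ q).+1)) => n.
split; first by apply: covers_split => j; have [] := LP j.
rewrite size_cat natrD mulrDl; apply: lerD; first by rewrite -exprM.
set N := (n + 2 - _)%N.
have sL j : (size (L j))%:R <= K * (c ^+ t.+1) ^+ j by have [] := LP j.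
apply: le_trans (size_split_acts N (exprn_gt0 _ c0) sL) _.
have Nn : N.+1%:R <= 2 * K2 * c ^+ n.
  have : N.+1%:R <= (2 * n.+1)%:R :> R by rewrite ler_nat /N; move: (n %/ q)%N => m; lia.
  rewrite natrM; have := linP n; lra.
have cN : c ^+ n * (c ^+ t.+1) ^+ N <= c ^+ (t.+1 + q.*2) * (c ^+ t) ^+ n.
  rewrite -!exprM -!exprD ler_weXn2l ?ltW //.
  exact: split_exponent_le.
apply: le_trans (ler_wpM2r _ Nn) _.
  by rewrite mulr_ge0 // mulr_ge0 ?sqr_ge0 // exprn_ge0 // exprn_ge0 // ltW.
have M0 : 0 <= 2 * K2 * (2 * K ^+ 2) by do 2!apply: mulr_ge0; rewrite ?sqr_ge0.
have := ler_wpM2l M0 cN.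
set A := c ^+ n; set B := _ ^+ N; set C := c ^+ _; set D := _ ^+ n => H.
have -> : 2 * K2 * A * (2 * (K ^+ 2 * B)) = 2 * K2 * (2 * K ^+ 2) * (A * B) by ring.
by apply: le_trans H _; lra.
Qed.

Fixpoint words (n : nat) : seq (seq letter) :=
  if n is m.+1 then
    [::] :: [seq z :: u | z <- [:: la; lc; ld], u <- words m]
  else [:: [::]].

Lemma mem_words n u : (size u <= n)%N -> u \in words n.
Proof.
elim: n u => [|n IH] [|z u] //; rewrite ltnS => un.
by case: z; rewrite /= !inE !mem_cat !map_f ?orbT // IH.
Qed.

Lemma size_words n : (size (words n) <= 4 ^ n)%N.
Proof.
elim: n => // n IH; rewrite /= !size_cat !size_map expnS /=.
have : (0 < 4 ^ n)%N by rewrite expn_gt0.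
lia.
Qed.

Lemma size_le_weight u : (size u <= weight u)%N.
Proof. by rewrite /weight; elim: u => //= -[] u /=; lia. Qed.

Lemma growth_bounded4 (R : realType) : growth_bounded (4 : R).
Proof.
exists 1, (fun n => [seq act u | u <- words n]) => n; split.
  move=> u un; apply: map_f; apply: mem_words.
  exact: leq_trans (size_le_weight u) un.
by rewrite size_map mul1r -natrX ler_nat size_words.
Qed.

Lemma growth_boundedW (R : realType) (c d : R) :
  0 <= c <= d -> growth_bounded c -> growth_bounded d.
Proof.
move=> /andP[c0 cd] [K [L LP]]; exists `|K|, L => n; have [Lc LK] := LP n.
split=> //; apply: le_trans LK (le_trans (ler_wpM2r _ (ler_norm K)) _).
  exact: exprn_ge0.
by rewrite ler_wpM2l // lerXn2r // nnegrE (le_trans c0).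
Qed.

Lemma growth_bounded_gt1 (R : realType) (c : R) : 1 < c -> growth_bounded c.
Proof.
move=> c1; have [q q0 [K FK]] := few_cd_acts c1.
(* The descent by powers of [d] starts above the trivial bound 4 and stops at [d ^+ q.*2 = c], the
   least exponent that the step allows. *)
have [d d1 dc] := @exists_root R c q.*2 c1 ltac:(by rewrite double_gt0).
have [T T4] := expr_unbounded 4 d1.
have d0 : 0 <= d by lra.
suff H j : growth_bounded (d ^+ (q.*2 + j)) -> growth_bounded (d ^+ q.*2).
  rewrite -dc; apply: (H T); apply: growth_boundedW (@growth_bounded4 R).
  by rewrite ler0n (le_trans T4) // ler_weXn2l ?leq_addl // ltW.
elim: j => [|j IH]; first by rewrite addn0.
rewrite addnS => dj; apply: IH; apply: (@growth_bounded_step R d q) dj => //.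
  exact: leq_addr.
have K0 : 0 <= K by have := FK 0; rewrite expr0 mulr1; apply: le_trans.
exists K => n; apply: le_trans (FK n) _; rewrite ler_wpM2l // -dc -exprM.
by rewrite ler_weXn2l ?ltW // leq_mul2r leq_addr orbT.
Qed.

Local Close Scope ring_scope.

(** * From positions to the topological full group *)

Lemma toeplitz_pow2 k : toeplitz (2 ^ k.*2.+2) = ld.
Proof.
rewrite /toeplitz oddX /= lognX logn_prime //= muln1 /= odd_double //.
Qed.

Lemma toeplitz_pow2D k j :
  (0 < j < 2 ^ k)%N -> toeplitz (2 ^ k + j) = toeplitz j.
Proof.
elim: k j => [|k IH] j /andP[j0 jk]; first by rewrite expn0 in jk; case: j j0 jk.
rewrite expnS mul2n in jk *; have [m [E|E]] := double_or j; subst j.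
  by rewrite -doubleD !toeplitz_double ?IH //; lia.
by rewrite [LHS]toeplitz_odd ?[RHS]toeplitz_odd //; lia.
Qed.

Lemma toeplitz_pow2B k j :
  (0 < j < 2 ^ k)%N -> toeplitz (2 ^ k - j) = toeplitz j.
Proof.
elim: k j => [|k IH] j /andP[j0 jk]; first by rewrite expn0 in jk; case: j j0 jk.
rewrite expnS mul2n in jk *; have [m [E|E]] := double_or j; subst j.
  by rewrite -doubleB !toeplitz_double ?IH //; lia.
by rewrite [LHS]toeplitz_odd ?[RHS]toeplitz_odd //; lia.
Qed.

Lemma toeplitz_aperiodic d : (0 < d)%N ->
  exists2 m, (0 < m)%N & toeplitz m != toeplitz (m + d).
Proof.
have [n] := ubnP d; elim: n d => // n IH d dn d0.
have [h [E|E]] := double_or d; subst d; last first.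
  exists 1 => //; rewrite (@toeplitz_odd 1) // eq_sym toeplitz_even //.
  by rewrite oddD /= odd_double.
have [h2 [E|E]] := double_or h; last first.
  (* For odd [h], the place [e.*2] carries [lc] and [e.*2 + h.*2 = m.*2.*2] carries [ld]. *)
  have [e [m [e_odd m_odd E1]]] :
      exists e m, [/\ odd e, odd m & e + h = m.*2]%N.
    have [h2_odd|h2_even] := boolP (odd h2).
      by exists 3, h2.+2; split=> //=; [rewrite h2_odd|lia].
    by exists 1, h2.+1; split=> //=; lia.
  exists e.*2; first by case: e e_odd E1.
  rewrite -doubleD E1 !toeplitz_double ?(toeplitz_odd e_odd) ?(toeplitz_odd m_odd) //.
  - by case: m m_odd {E1}.
  - by rewrite -E1; lia.
  - by case: e e_odd {E1}.
have [||m m0 mh] := IH h; try lia.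
exists m.*2; first by rewrite double_gt0.
rewrite -doubleD !toeplitz_double //; last by lia.
(* [shift_letter] identifies only [la] and [ld]; as [h] is even, [m] and [m + h] carry [la] both or
   neither. *)
apply: contraNneq mh; have [m_odd|m_even] := boolP (odd m).
  by rewrite !toeplitz_odd // oddD m_odd E odd_double.
have : toeplitz m != la by rewrite toeplitz_even.
have : toeplitz (m + h) != la.
  by rewrite toeplitz_even // oddD (negPf m_even) E odd_double.
by do 2!case: (toeplitz _).
Qed.

(* Bi-infinite: the reversed fixed point, the letter [ld], the fixed point. *)
Definition omega0 : bistring := fun j => toeplitz `|j|%N.

(** Around a large power of 4, [toeplitz] has central letter [ld] and reads on both sides as it does
    from 1, so every window of [omega0] reappears there. *)
Lemma omega0_Omega : Omega omega0.
Proof.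
move=> u _ [i uE].
pose k := (`|i| + size u)%N.
have [M M_gt [ME [MD MB]]] : exists2 M : nat, (k < M)%N & toeplitz M = ld /\
    (forall j, (0 < j < M)%N -> toeplitz (M + j) = toeplitz j) /\
    (forall j, (0 < j < M)%N -> toeplitz (M - j) = toeplitz j).
  exists (2 ^ k.*2.+2)%N.
    have kk : (k <= k.*2.+2)%N by lia.
    exact: leq_trans (ltn_expl k (ltnSn 1)) (leq_pexp2l (ltn0Sn 1) kk).
  split; first exact: toeplitz_pow2.
  by split=> j; [exact: toeplitz_pow2D|exact: toeplitz_pow2B].
(* The [- 1] is due to [xi_Mu] being indexed from 0. *)
rewrite /k in M_gt; exists (absz (M%:Z + i - 1)%R).
rewrite {1}uE; apply/eq_in_map => j; rewrite mem_iota add0n => /andP[_ ju].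
rewrite xi_MuE /omega0.
have -> : (absz (M%:Z + i - 1)%R + j).+1 = absz (M%:Z + (i + j%:Z))%R by lia.
have ijk : (absz (i + j%:Z)%R < M)%N.
  apply: leq_ltn_trans M_gt; apply: (@leq_trans (`|i| + j)); first by lia.
  by rewrite leq_add2l ltnW.
case: (ltgtP (i + j%:Z)%R 0%R) => ij0.
- by rewrite -[LHS]MB; [congr toeplitz|]; lia.
- by rewrite -[LHS]MD; [congr toeplitz|]; lia.
by rewrite ij0 addr0 absz_nat ME.
Qed.

Local Open Scope group_scope.

Definition delta_prod (u : seq letter) : tfg sigma := \prod_(z <- u) delta z.

Local Close Scope group_scope.

(** With the dot of [w] at position [p], the displacement never exceeds the number of letters read,
    so the letters consulted stay in the window of agreement; [N < p] keeps away from the end 0. *)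
Lemma delta_prod_window (w : Omega) (N p : nat) u :
  (size u <= N)%N -> (N < p)%N ->
  (forall j : int, (- N%:Z <= j <= N%:Z + 1)%R ->
     set_val w j = toeplitz (absz (p%:Z + j)%R)) ->
  (absz ((act u p)%:Z - p%:Z)%R <= size u)%N /\
  delta_prod u w = Omega_shift ((act u p)%:Z - p%:Z)%R w.
Proof.
move=> uN Np wE; elim: u uN => [|z u IH] uN.
  by rewrite /= subrr /delta_prod big_nil Omega_shift0.
have [pu E] := IH (ltnW uN); rewrite /= in uN.
rewrite /delta_prod big_cons /= -/(delta_prod u).
rewrite E; move: (act u p) pu {E IH} => a.
set k := (a%:Z - p%:Z)%R => pu.
have w1 : set_val (Omega_shift k w) 1%R = toeplitz a.+1.
  change (set_val w (1 + k)%R = toeplitz a.+1).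
  by rewrite wE; [congr toeplitz; rewrite /k|rewrite /k in pu *]; lia.
have w0 : set_val (Omega_shift k w) 0%R = toeplitz a.
  change (set_val w (0 + k)%R = toeplitz a).
  by rewrite wE; [congr toeplitz; rewrite /k|rewrite /k in pu *]; lia.
have a0 : (0 < a)%N by rewrite /k in pu; lia.
rewrite /delta_fun w1 w0 /move a0 /=; case: ifP => _; last case: ifP => _ //.
- split; first by rewrite /k in pu; lia.
  by rewrite /sigma /= Omega_shift_comp; congr Omega_shift; rewrite /k; lia.
- split; first by rewrite /k in pu; lia.
  by rewrite /sigma /= Omega_shift_comp; congr Omega_shift; rewrite /k; lia.
- by split=> //; apply: leqW.
Qed.

(** Every window of a string in [Omega] occurs in [xi_Mu], so the half-line determines the
    element. *)
Lemma delta_prod_eq u v : act u = act v -> delta_prod u = delta_prod v.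
Proof.
move=> uv; apply/val_inj/homeo_ext => w.
pose N := maxn (size u) (size v).
pose W := mkseq (fun j => set_val w (j%:Z - N%:Z)%R) N.*2.+2.
have [//||i iE] := set_valP w W.
  exists (- N%:Z)%R; rewrite size_mkseq; apply: eq_mkseq => j; congr (set_val w _); lia.
have wE (j : int) : (- N%:Z <= j <= N%:Z + 1)%R ->
    set_val w j = toeplitz (absz ((i + N).+1%:Z + j)%R).
  move=> /andP[j1 j2]; have [m [jm mN]] :
      exists m : nat, j = (m%:Z - N%:Z)%R /\ (m < N.*2.+2)%N.
    by exists (absz (j + N%:Z)%R); split; lia.
  move/(congr1 (fun s => nth la s m)): iE; rewrite size_mkseq !nth_mkseq // jm => ->.
  by rewrite xi_MuE; congr toeplitz; lia.
have NN : (N < (i + N).+1)%N by lia.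
have [_ /= ->] := delta_prod_window (leq_maxl _ _ : (size u <= N)%N) NN wE.
have [_ /= ->] := delta_prod_window (leq_maxr _ _ : (size v <= N)%N) NN wE.
by rewrite uv.
Qed.

(** Both words send [omega0] shifted to [p] to the same string, and aperiodicity makes the
    displacements equal. Near 0 the half-line ends while [omega0] continues, hence only far
    positions. *)
Lemma act_eq_far u v p : delta_prod u = delta_prod v ->
  (size u < p)%N -> (size v < p)%N -> act u p = act v p.
Proof.
move=> uv up vp.
pose w0 : Omega := SigSub (mem_set omega0_Omega).
pose w := Omega_shift p%:Z w0.
have wE N (j : int) : (- N%:Z <= j <= N%:Z + 1)%R ->
    set_val w j = toeplitz (absz (p%:Z + j)%R).
  move=> _; change (toeplitz (absz (j + p%:Z)%R) = toeplitz (absz (p%:Z + j)%R)).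
  by rewrite addrC.
have [_ Eu] := delta_prod_window (leqnn (size u)) up (wE _).
have [_ Ev] := delta_prod_window (leqnn (size v)) vp (wE _).
move: Eu; rewrite uv Ev !Omega_shift_comp !subrKC => E.
have {}E (n : int) : toeplitz (absz (n + (act u p)%:Z)%R)
    = toeplitz (absz (n + (act v p)%:Z)%R).
  exact: (congr1 (fun x : Omega => set_val x n) (esym E)).
apply/eqP; case: (ltngtP (act u p) (act v p)) => // lt.
- have [m m0] := @toeplitz_aperiodic (act v p - act u p) ltac:(lia).
  have := E (m%:Z - (act u p)%:Z)%R; rewrite subrK absz_nat => ->.
  by move/eqP; case; congr toeplitz; lia.
- have [m m0] := @toeplitz_aperiodic (act u p - act v p) ltac:(lia).
  have := E (m%:Z - (act v p)%:Z)%R; rewrite subrK absz_nat => <-.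
  by move/eqP; case; congr toeplitz; lia.
Qed.

(** * Doubly exponentially many distinct elements *)

(** Conjugation by [la] swaps the sections, so [u] and [v] land in different coordinates. *)
Definition branch (u v : seq letter) : seq letter :=
  subst_word u ++ la :: subst_word v ++ [:: la].

(* The section of [subst_word u] at the digit [true]; the one at [false] is
   [u] itself. *)
Definition side_section (u : seq letter) : seq letter :=
  flatten [seq match z with la => [:: ld] | lc => [::] | ld => [:: la] end
             | z <- u].

Lemma subst_word_cons z u : subst_word (z :: u) = substitution z ++ subst_word u.
Proof. by []. Qed.

Lemma parity_subst u : parity (subst_word u) = false.
Proof.
elim: u => // z u IH; rewrite subst_word_cons parity_cat IH.
by case: z.
Qed.

Lemma section_subst u : section false (subst_word u) = u /\
  section true (subst_word u) = side_section u.
Proof.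
elim: u => // z u [IH1 IH2].
by rewrite subst_word_cons !section_cat IH1 IH2 parity_subst; case: z.
Qed.

Lemma section_branch u v : section false (branch u v) = u ++ side_section v /\
  section true (branch u v) = side_section u ++ v.
Proof.
have [su1 su2] := section_subst u; have [sv1 sv2] := section_subst v.
have p1 : parity (subst_word v ++ [:: la]) by rewrite parity_cat parity_subst.
have p2 : parity (la :: subst_word v ++ [:: la]) = false.
  by rewrite -cat1s parity_cat p1.
by rewrite /branch !section_cat p2 /= !section_cat /= su1 su2 sv1 sv2 !cats0.
Qed.

(* Evenness of all letter counts makes the triviality of [side_section]
   hereditary under [branch], by [act_side_subst]. *)
Definition balanced (u : seq letter) : Prop :=
  (forall z, ~~ odd (count_mem z u)) /\ act (side_section u) =1 id.

(** [la] becomes [aca] and then [dd], [lc] becomes [d] and then [a], [ld] becomes [c] and then the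
    empty word. *)
Lemma act_side_subst u p :
  act (side_section (subst_word u)) p =
  if odd (count_mem lc u) then move la p else p.
Proof.
elim: u p => // z u IH p.
rewrite subst_word_cons /side_section map_cat flatten_cat -/(side_section _).
rewrite act_cat IH oddD; case: z => /=; last by [].
  by rewrite /act /= moveK.
by case: (odd _); rewrite /act /= ?moveK.
Qed.

Lemma balanced_branch u v : balanced u -> balanced v -> balanced (branch u v).
Proof.
have count_subst z w : balanced w -> ~~ odd (count_mem z (subst_word w)).
  move=> [ew _].
  have -> : count_mem z (subst_word w) = (match z with
      la => (count_mem la w).*2 | lc => count_mem la w + count_mem ld w
    | ld => count_mem lc w end)%N.
    elim: w {ew} => [|x w IH]; first by case: z.
    by rewrite subst_word_cons count_cat IH; case: z {IH}; case: x => /=; lia.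
  by case: z; rewrite ?odd_double ?oddD ?(negPf (ew _)).
move=> bu bv; split=> [z|p].
  rewrite /branch count_cat /= count_cat /= !oddD !(negPf (count_subst z _ _)) //=.
  by case: (la == z).
rewrite /branch /side_section map_cat flatten_cat act_cat -/(side_section _).
rewrite map_cons map_cat -cat1s !flatten_cat -!/(side_section _) /=.
have [[eu _] [ev _]] := (bu, bv).
rewrite !act_side_subst (negPf (eu _)) /act /= foldr_cat.
by rewrite -/(act _ _) act_side_subst (negPf (ev _)) /= moveK.
Qed.

(** Side sections of balanced words act trivially, which leaves [u] and [v] as the two sections;
    [undigit x p] is at least [p], so far positions stay far. *)
Lemma branch_far_inj u v u' v' P :
  balanced u -> balanced v -> balanced u' -> balanced v' ->
  (forall p, (P <= p)%N -> act (branch u v) p = act (branch u' v') p) ->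
  (forall p, (P <= p)%N -> act u p = act u' p) /\
  (forall p, (P <= p)%N -> act v p = act v' p).
Proof.
move=> [_ bu] [_ bv] [_ bu'] [_ bv'] E.
have half x p : (P <= p)%N ->
    act (section x (branch u v)) p = act (section x (branch u' v')) p.
  move=> Pp; have := half_act (branch u v) (undigit x p).
  rewrite E ?half_act ?digit_undigit ?half_undigit //.
  by rewrite /undigit; lia.
have [s1 s2] := section_branch u v; have [s1' s2'] := section_branch u' v'.
split=> p Pp.
  by have := half false p Pp; rewrite s1 s1' !act_cat bv bv'.
by have := half true p Pp; rewrite s2 s2' !act_cat bu bu'.
Qed.

(** The word [acac] is balanced, its side section being [dd], and acts nontrivially arbitrarily far
    out. *)
Fixpoint branch_words (k : nat) : seq (seq letter) :=
  if k is j.+1 then [seq branch u v | u <- branch_words j, v <- branch_words j]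
  else [:: [::]; [:: la; lc; la; lc]].

Lemma balanced_branch_words k u : u \in branch_words k -> balanced u.
Proof.
elim: k u => [|k IH] u.
  rewrite !inE => /orP[] /eqP ->; split=> //; first by case.
  by move=> p; rewrite /act /= moveK.
by move=> /allpairsP[[v w] [/= /IH bv /IH bw ->]]; exact: balanced_branch.
Qed.

Lemma size_subst_word_le u : (size (subst_word u) <= 3 * size u)%N.
Proof.
elim: u => // z u IH; rewrite subst_word_cons size_cat mulnS leq_add //.
by case: z.
Qed.

Lemma size_mem_branch_words k u : u \in branch_words k -> (size u <= 4 * 8 ^ k)%N.
Proof.
elim: k u => [|k IH] u; first by rewrite !inE => /orP[] /eqP ->.
move=> /allpairsP[[v w] [/= /IH bv /IH bw ->]].
rewrite /branch size_cat /= size_cat /= expnS.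
have : (0 < 8 ^ k)%N by rewrite expn_gt0.
have := leq_trans (size_subst_word_le v) (leq_mul (leqnn 3) bv).
have := leq_trans (size_subst_word_le w) (leq_mul (leqnn 3) bw).
lia.
Qed.

Lemma size_branch_words k : size (branch_words k) = (2 ^ (2 ^ k))%N.
Proof.
by elim: k => // k IH; rewrite /= size_allpairs IH -expnD addnn -mul2n -expnS.
Qed.

Lemma branch_words_far_inj k u v P : u \in branch_words k -> v \in branch_words k ->
  (forall p, (P <= p)%N -> act u p = act v p) -> u = v.
Proof.
elim: k u v => [|k IH] u v; last first.
  move=> /allpairsP[[u1 u2] [/= u1k u2k ->]] /allpairsP[[v1 v2] [/= v1k v2k ->]].
  move=> /branch_far_inj[]; try exact: (@balanced_branch_words k).
  by move=> /(IH _ _ u1k v1k) -> /(IH _ _ u2k v2k) ->.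
(* The edge to the right of [4P + 1] carries [lc]; the path goes to [4P + 2], [4P + 3], and ends at
   [4P + 5] or [4P + 2]. *)
have moved : act [:: la; lc; la; lc] P.*2.*2.+1 != P.*2.*2.+1.
  rewrite /act /= move_doubleS /= (@toeplitz_odd P.*2.+1) /= ?odd_double //.
  rewrite -doubleS move_double /= move_doubleS /=.
  case: ifP => _; last by rewrite move_doubleS /=; lia.
  by rewrite -doubleS move_double /=; lia.
have Pp : (P <= P.*2.*2.+1)%N by lia.
rewrite !inE => /orP[] /eqP -> /orP[] /eqP -> // /(_ _ Pp) E.
  by rewrite -E eqxx in moved.
by rewrite E eqxx in moved.
Qed.

Lemma uniq_branch_words k : uniq (branch_words k).
Proof.
elim: k => // k IH; rewrite /= allpairs_uniq // => -[u v] [u' v'].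
move=> /allpairsP[[? ?] [/= uk vk [-> ->]]] /allpairsP[[? ?] [/= uk' vk' [-> ->]]] E.
have [] := @branch_far_inj _ _ _ _ 0 (balanced_branch_words uk) (balanced_branch_words vk)
  (balanced_branch_words uk') (balanced_branch_words vk').
  by move=> p _; rewrite [branch _ _]E.
by move=> /(branch_words_far_inj uk uk') -> /(branch_words_far_inj vk vk') ->.
Qed.

(** * Word balls and growth *)

Section WordBalls.
Variable G : groupType.
Implicit Types A B : set G.
Local Open Scope group_scope.

Lemma word_ball_mul A m n x y :
  word_ball A m x -> word_ball A n y -> word_ball A (m + n) (x * y).
Proof.
move=> [s [sm sA ->]] [t [tn tA ->]]; exists (s ++ t).
split; first by rewrite size_cat leq_add.
  by move=> z; rewrite mem_cat => /orP[/sA|/tA].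
by rewrite big_cat.
Qed.

Lemma word_ball_inv A n x : word_ball A n x -> word_ball A n x^-1.
Proof.
move=> [s [sn sA ->]]; exists (rev [seq y^-1 | y <- s]).
split; first by rewrite size_rev size_map.
  move=> z; rewrite mem_rev => /mapP[y /sA yA ->]; rewrite invgK.
  by case: yA; [right|left].
elim: {sn sA} s => [|y s IH]; first by rewrite !big_nil invg1.
by rewrite big_cons invgM IH /= rev_cons -cats1 big_cat big_seq1.
Qed.

Lemma word_ball1 A n : word_ball A n 1.
Proof. by exists [::]; split=> //; rewrite big_nil. Qed.

Lemma sub_word_ball A x : A x -> word_ball A 1 x.
Proof.
move=> Ax; exists [:: x]; split=> //; last by rewrite big_seq1.
by move=> y; rewrite inE => /eqP ->; left.
Qed.

Lemma word_ball_le A m n : (m <= n)%N -> word_ball A m `<=` word_ball A n.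
Proof. by move=> mn _ [s [sm sA ->]]; exists s; split=> //; exact: leq_trans mn. Qed.

Lemma generatedP A x : generated A x <-> exists n, word_ball A n x.
Proof.
split=> [|[n [s [_ sA ->]]] H [[H1 HB] AH]].
  move/(_ [set y | exists n, word_ball A n y]); apply; split.
    split; first by apply/mem_set; exists 0%N; exact: word_ball1.
    move=> y z /set_mem[m my] /set_mem[n nz]; apply/mem_set; exists (m + n)%N.
    exact: word_ball_mul my (word_ball_inv nz).
  by move=> y /sub_word_ball Ay; exists 1%N.
apply/set_mem; elim: s sA => [|y s IH] sA; first by rewrite big_nil.
rewrite big_cons.
have Hs : \prod_(z <- s) z \in H.
  by apply: IH => z zs; apply: sA; rewrite inE zs orbT.
have HV z : z \in H -> z^-1 \in H by move=> zH; rewrite -div1g; exact: HB.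
have Hy : y \in H.
  have [/AH/mem_set //|/AH/mem_set/HV] := sA y (mem_head _ _).
  by rewrite invgK.
by rewrite -[X in _ * X]invgK; apply: HB => //; exact: HV.
Qed.

Lemma sub_generated A : A `<=` generated A.
Proof. by move=> x /sub_word_ball Ax; apply/generatedP; exists 1%N. Qed.

Lemma word_ball_trans A B k n : A `<=` word_ball B k ->
  word_ball A n `<=` word_ball B (k * n).
Proof.
move=> AB _ [s [sn sA ->]]; apply: (word_ball_le (leq_mul (leqnn k) sn)).
elim: s {sn} sA => [|x s IH] sA; first by rewrite big_nil; exact: word_ball1.
rewrite big_cons mulnS; apply: word_ball_mul.
  have [/AB //|/AB/word_ball_inv] := sA x (mem_head _ _).
  by rewrite invgK.
by apply: IH => z zs; apply: sA; rewrite inE zs orbT.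
Qed.

Lemma finite_sub_word_ball A B : finite_set A -> A `<=` generated B ->
  exists k, A `<=` word_ball B k.
Proof.
move=> /finite_seqP[s ->]; elim: s => [|x s IH] sB; first by exists 0%N.
have [k sk] : exists k, [set` s] `<=` word_ball B k.
  by apply: IH => y ys; apply: sB; rewrite /= inE ys orbT.
have /generatedP[j xj] : generated B x by apply: sB; rewrite /= inE eqxx.
exists (j + k)%N => y; rewrite /= inE => /orP[/eqP ->|ys].
  exact: word_ball_le (leq_addr _ _) _ xj.
by apply: word_ball_le (leq_addl _ _) _ (sk y ys).
Qed.

End WordBalls.

(** * Growth of the group generated by the three involutions *)

Definition deltas : set (tfg sigma) := [set delta la; delta lc; delta ld].

Lemma deltaV z : ((delta z)^-1 = delta z)%g.
Proof. by apply/val_inj/homeo_ext. Qed.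

Lemma deltas_delta z : deltas (delta z).
Proof. by case: z; rewrite /deltas /=; auto. Qed.

Lemma word_ball_deltas n g : word_ball deltas n g <->
  exists2 u, (size u <= n)%N & g = delta_prod u.
Proof.
split=> [[s [sn sd ->]]|[u un ->]].
  have dP x : deltas x \/ deltas x^-1%g -> exists z, x = delta z.
    have d y : deltas y -> exists z, y = delta z.
      by move=> [[|]|] ->; [exists la|exists lc|exists ld].
    by case=> /d // [z /(canRL invgK)]; rewrite deltaV; exists z.
  have [u [us ->]] : exists u, size u = size s /\ (\prod_(x <- s) x)%g = delta_prod u.
    elim: s sd {sn} => [|x s IH] sd; first by exists [::]; rewrite /delta_prod !big_nil.
    have [z ->] := dP x (sd x (mem_head _ _)).
    have [|u [us E]] := IH; first by move=> y ys; apply: sd; rewrite inE ys orbT.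
    by exists (z :: u); rewrite /delta_prod !big_cons E /= us.
  by exists u => //; rewrite us.
exists [seq delta z | z <- u]; split; first by rewrite size_map.
  by move=> _ /mapP[z _ ->]; left; exact: deltas_delta.
by rewrite big_map.
Qed.

Lemma weight_le u : (weight u <= 3 * size u)%N.
Proof. by rewrite /weight; elim: u => //= -[] u /=; lia. Qed.

Lemma card_le_covers L n (B : set (tfg sigma)) : covers L (3 * n) ->
  B `<=` word_ball deltas n -> finite_set B /\ (#|` fset_set B| <= size L)%N.
Proof.
move=> Ln Bn.
(* Well defined by [delta_prod_eq]; the value 1 on other maps is a default. *)
have [f fP] : {f : (nat -> nat) -> tfg sigma & forall u, f (act u) = delta_prod u}.
  exists (fun h => if pselect (exists u, act u = h) is left e then delta_prod (sval (cid e))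
    else 1%g) => u.
  case: pselect => [e|[]]; last by exists u.
  exact/delta_prod_eq/(svalP (cid e)).
have BL : B `<=` [set` [seq f h | h <- L]].
  move=> g /Bn /word_ball_deltas[u un ->]; rewrite /= -fP; apply: map_f; apply: Ln.
  by rewrite (leq_trans (weight_le u)) // leq_mul2l un orbT.
have fB : finite_set B := sub_finite_set BL (finite_seq _).
split=> //; rewrite -(size_map f L); apply: uniq_leq_size => // g.
by rewrite in_fset_set // => /set_mem /BL.
Qed.

Lemma card_ge_word_ball k (B : set (tfg sigma)) : finite_set B ->
  word_ball deltas (4 * 8 ^ k) `<=` B -> (2 ^ 2 ^ k <= #|` fset_set B|)%N.
Proof.
move=> fB kB; rewrite -size_branch_words -(size_map delta_prod).
apply: uniq_leq_size.
  rewrite map_inj_in_uniq ?uniq_branch_words // => u v uk vk uv.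
  apply: (branch_words_far_inj uk vk (P := (size u + size v).+1)) => p pP.
  by apply: act_eq_far uv _ _; apply: leq_trans pP; rewrite ltnS ?leq_addl ?leq_addr.
move=> _ /mapP[u uk ->]; rewrite in_fset_set //; apply/mem_set/kB.
by apply/word_ball_deltas; exists u => //; exact: size_mem_branch_words.
Qed.

(** With [j = k./2], [2 ^ k] is at least the square of [j.+1], and one factor [j.+1] bounds
    [2 * a + b]. *)
Lemma linear_le_expn a b k : (2 * (2 * a + b) <= k)%N -> (a * k + b <= 2 ^ k)%N.
Proof.
move=> abk; pose j := k./2.
have kj : (2 ^ (j + j) <= 2 ^ k)%N by rewrite leq_exp2l // /j; lia.
apply: leq_trans kj; rewrite expnD.
have jj := leq_mul (ltn_expl j (ltnSn 1)) (ltn_expl j (ltnSn 1)).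
apply: leq_trans jj; apply: (@leq_trans (j.+1 * (2 * a + b))).
  have -> : k = (odd k + j.*2)%N by rewrite odd_double_half.
  case: (odd k); nia.
by rewrite leq_mul2l /= /j; lia.
Qed.

Local Open Scope ring_scope.

Lemma growth_upper (R : realType) (c : R) (A : set (tfg sigma)) k :
  1 < c -> A `<=` word_ball deltas k ->
  \forall n \near \oo, (growth A n)%:R < c ^+ n.
Proof.
move=> c1 Ak.
(* This makes [e] below a square root of [c]: one [e ^+ n] bounds the growth up to [K], the other
   absorbs [K]. *)
have [d d1 dc] := @exists_root R c (3 * k.+1 * 2) c1 isT.
have d0 : 0 < d by lra.
have [K [L LP]] := growth_bounded_gt1 d1.
pose e := d ^+ (3 * k.+1).
have e1 : 1 < e by rewrite exprn_egt1.
have [N KN] := expr_unbounded (K + 1) e1.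
exists N => // n /= Nn.
have [Ln sL] := LP (3 * (k.+1 * n))%N.
have An : word_ball A n `<=` word_ball deltas (k.+1 * n).
  apply: subset_trans (word_ball_trans Ak) _.
  by apply: word_ball_le; rewrite leq_mul2r leqnSn orbT.
have [_ gA] := card_le_covers Ln An.
apply: (@le_lt_trans _ _ (K * e ^+ n)).
  rewrite /e -exprM -mulnA; apply: le_trans sL.
  by rewrite ler_nat.
have eN : K + 1 <= e ^+ n.
  by rewrite (le_trans KN) // ler_weXn2l // ltW.
have -> : c ^+ n = e ^+ n * e ^+ n by rewrite -dc exprM -/e -exprMn expr2.
by rewrite ltr_pM2r ?exprn_gt0 //; lra.
Qed.

Lemma growth_lower (R : realType) (alpha : R) (A : set (tfg sigma)) k :
  (forall n, finite_set (word_ball A n)) -> deltas `<=` word_ball A k ->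
  \forall n \near \oo, n%:R `^ alpha < (growth A n)%:R.
Proof.
move=> fA dk.
pose r := (Num.bound `|alpha|).+1.
have alr : alpha <= r%:R.
  have := archi_boundP (normr_ge0 alpha); have := ler_norm alpha.
  by rewrite /r -natr1; lra.
pose D := (k.+1 * 4)%N.
(* For [D * 8 ^ j <= n < D * 8 ^ j.+1] the ball has at least [2 ^ 2 ^ j] elements, while [n ^ r] is
   below [2 ^ (3 * r * j + (D + 3) * r)]; [m] is the threshold of [linear_le_expn] for this
   exponent. *)
pose m := (2 * (2 * (3 * r) + (D + 3) * r))%N.
exists (D * 8 ^ m)%N => // n /= mn.
have n0 : (0 < n)%N by apply: leq_trans mn; rewrite muln_gt0 expn_gt0.
pose j := trunc_log 8 (n %/ D).
have D0 : (0 < D)%N by [].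
have mnD : (8 ^ m <= n %/ D)%N by rewrite leq_divRL // mulnC.
have nD0 : (0 < n %/ D)%N by apply: leq_trans mnD; rewrite expn_gt0.
have jm : (m <= j)%N by apply: trunc_log_max.
have /andP[j1 j2] : (8 ^ j <= n %/ D < 8 ^ j.+1)%N by exact: trunc_log_bounds.
have gA : (2 ^ 2 ^ j <= growth A n)%N.
  apply: card_ge_word_ball => //; apply: subset_trans (word_ball_trans dk) _.
  apply: word_ball_le; rewrite leq_divRL // in j1; apply: leq_trans j1.
  by rewrite /D; move: (8 ^ j)%N => x; nia.
apply: (@le_lt_trans _ _ (n%:R `^ r%:R)); first by rewrite ler_powR // ler1n.
rewrite powR_mulrn // -natrX ltr_nat; apply: leq_trans gA.
rewrite ltn_divLR // in j2.
apply: (@leq_trans ((8 ^ j.+1 * D) ^ r)); first by rewrite ltn_exp2r.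
apply: (@leq_trans ((2 ^ (3 * j.+1) * 2 ^ D) ^ r)).
  rewrite leq_exp2r // leq_mul //; first by rewrite expnM.
  exact/ltnW/ltn_expl.
rewrite -expnD -expnM leq_exp2l //.
have := linear_le_expn jm; apply: leq_trans.
by rewrite mulnDl mulnS; lia.
Qed.

Local Close Scope ring_scope.

Theorem theorem3p18 (R : realType) :
  intermediate_growth R
    (generated [set delta la; delta lc; delta ld] : set (tfg sigma)).
Proof.
rewrite -/deltas.
have fd : finite_set deltas by rewrite /deltas !finite_setU; do ?split; exact: finite_set1.
split.
(* A finite group of order [N] would satisfy [2 ^ 2 ^ N <= N]. *)
- move=> fH; have := @card_ge_word_ball #|` fset_set (generated deltas)| _ fH.
  have dH n : word_ball deltas n `<=` generated deltas.
    by move=> g gn; apply/generatedP; exists n.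
  move/(_ (dH _)); apply/negP; rewrite -ltnNge.
  by apply: leq_trans (ltn_expl _ (ltnSn 1)) _; rewrite leq_exp2l // ltnW // ltn_expl.
- by exists deltas.
move=> A fA AH c alpha c1 _.
have Ad : A `<=` generated deltas by rewrite -AH; exact: sub_generated.
have dA : deltas `<=` generated A by rewrite AH; exact: sub_generated.
have [k Ak] := finite_sub_word_ball fA Ad.
have [l dl] := finite_sub_word_ball fd dA.
(* Finiteness comes first, since [growth] is a true count only on finite balls; the trivial bound 4
   suffices. *)
have fB n : finite_set (word_ball A n).
  have [K [L LP]] := @growth_bounded4 R.
  have [Ln _] := LP (3 * (k * n))%N.
  by have [] := card_le_covers Ln (word_ball_trans Ak).
have lo := growth_lower alpha fB dl; have up := growth_upper c1 Ak.
by near=> n; apply/andP; split; near: n.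
Unshelve. all: by end_near.
Qed.
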